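(* Let $X\in\{\,\text{(empty)},\mathrm N,\mathrm T,\mathrm W,\mathrm C,\mathrm A,\mathrm{NA}\}$, and let $\mathsf{G.N}X$ and $\mathsf{H.N}X$ be the corresponding sequent and hypersequent calculi. For every formula $A$, if the sequent $\Rightarrow A$ is derivable in $\mathsf{G.N}X$, then the hypersequent $\Rightarrow A$ is derivable in $\mathsf{H.N}X$.
   Context: Language: formulas $A ::= p \mid \bot \mid A\to A \mid A \preccurlyeq A$ over countably many atoms; $\top$ defined as usual. Sequent calculi. Sequents $\Gamma\Rightarrow\Delta$: $\Gamma,\Delta$ finite multisets of formulas. Rules (write $\Sigma^{\preccurlyeq}$ for $C_1\preccurlyeq D_1,\dots,C_n\preccurlyeq D_n$; $\Gamma^{\preccurlyeq}$, $\Delta^{\preccurlyeq}$ for the $\preccurlyeq$-formulas in $\Gamma$, $\Delta$): init: $\Gamma,p\Rightarrow p,\Delta$; $\bot_L$: $\Gamma,\bot\Rightarrow\Delta$; $\to_L$: from $\Gamma\Rightarrow A,\Delta$ and $\Gamma,B\Rightarrow\Delta$ infer $\Gamma,A\to B\Rightarrow\Delta$; $\to_R$: from $\Gamma,A\Rightarrow B,\Delta$ infer $\Gamma\Rightarrow A\to B,\Delta$. $\mathrm{CP}_n$: from $\{C_k\Rightarrow A,D_1,\dots,D_{k-1}\}_{1\le k\le n}$ and $B\Rightarrow A,D_1,\dots,D_n$ infer $\Gamma,\Sigma^{\preccurlyeq}\Rightarrow A\preccurlyeq B,\Delta$. $\mathrm N_n$: from $\{C_k\Rightarrow D_1,\dots,D_{k-1}\}_{k\le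 n}$ and $\Rightarrow D_1,\dots,D_n$ infer $\Gamma,\Sigma^{\preccurlyeq}\Rightarrow\Delta$. $\mathrm T_n$: from $\{C_k\Rightarrow D_1,\dots,D_{k-1}\}_{k\le n}$ and $\Gamma,\Sigma^{\preccurlyeq}\Rightarrow D_1,\dots,D_n,\Delta$ infer $\Gamma,\Sigma^{\preccurlyeq}\Rightarrow\Delta$. $\mathrm W_n$: from $\{C_k\Rightarrow A,D_1,\dots,D_{k-1}\}_{k\le n}$ and $\Gamma,\Sigma^{\preccurlyeq}\Rightarrow A,A\preccurlyeq B,D_1,\dots,D_n,\Delta$ infer $\Gamma,\Sigma^{\preccurlyeq}\Rightarrow A\preccurlyeq B,\Delta$. $\mathrm W_0$: from $\Gamma\Rightarrow A\preccurlyeq B,A,\Delta$ infer $\Gamma\Rightarrow A\preccurlyeq B,\Delta$. $\mathrm C_0$: from $\Gamma,A\preccurlyeq B,A\Rightarrow\Delta$ and $\Gamma,A\preccurlyeq B\Rightarrow B,\Delta$ infer $\Gamma,A\preccurlyeq B\Rightarrow\Delta$. $\mathrm A_n$: from $\{\Gamma^{\preccurlyeq},\Sigma^{\preccurlyeq},C_k\Rightarrow A\preccurlyeq B,A,D_1,\dots,D_{k-1},\Delta^{\preccurlyeq}\}_{k\le n}$ and $\Gamma^{\preccurlyeq},\Sigma^{\preccurlyeq},B\Rightarrow A\preccurlyeq B,A,D_1,\dots,D_n,\Delta^{\preccurlyeq}$ infer $\Gamma,\Sigma^{\preccurlyeq}\Rightarrow A\preccurlyeq B,\Delta$. $\mathrm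 N^A_n$: from $\{\Gamma^{\preccurlyeq},\Sigma^{\preccurlyeq},C_k\Rightarrow D_1,\dots,D_{k-1},\Delta^{\preccurlyeq}\}_{k\le n}$ and $\Gamma^{\preccurlyeq},\Sigma^{\preccurlyeq}\Rightarrow D_1,\dots,D_n,\Delta^{\preccurlyeq}$ infer $\Gamma,\Sigma^{\preccurlyeq}\Rightarrow\Delta$. $\mathsf{G.N}=\{\mathrm{init},\bot_L,\to_L,\to_R\}\cup\{\mathrm{CP}_n\mid n\ge0\}$; $\mathsf{G.NN}=\mathsf{G.N}\cup\{\mathrm N_n\mid n\ge1\}$; $\mathsf{G.NT}=\mathsf{G.N}\cup\{\mathrm T_n\mid n\ge1\}$; $\mathsf{G.NW}=\mathsf{G.N}\cup\{\mathrm W_n\mid n\ge0\}\cup\{\mathrm T_n\mid n\ge1\}$; $\mathsf{G.NC}=\mathsf{G.N}\cup\{\mathrm W_0,\mathrm C_0\}$; $\mathsf{G.NA}=\{\mathrm{init},\bot_L,\to_L,\to_R\}\cup\{\mathrm A_n\mid n\ge0\}$; $\mathsf{G.NNA}=\mathsf{G.NA}\cup\{\mathrm N^A_n\mid n\ge1\}$. Hypersequent calculi. A block $[\Sigma\lhd A]$: finite multiset $\Sigma$ of formulas and formula $A$; a sequent with blocks $\Gamma\Rightarrow\Delta$: $\Gamma$ finite multiset of formulas, $\Delta$ finite multiset of formulas and blocks; a hypersequent: finite multiset $\Gamma_1\Rightarrow\Delta_1\mid\dots\mid\Gamma_n\Rightarrow\Delta_n$ of such. Rules ($\mathcal G$ =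 other components): init: $\mathcal G\mid\Gamma,p\Rightarrow p,\Delta$; $\bot_L$: $\mathcal G\mid\Gamma,\bot\Rightarrow\Delta$; $\to_L$: from $\mathcal G\mid\Gamma,A\to B,B\Rightarrow\Delta$ and $\mathcal G\mid\Gamma,A\to B\Rightarrow\Delta,A$ infer $\mathcal G\mid\Gamma,A\to B\Rightarrow\Delta$; $\to_R$: from $\mathcal G\mid\Gamma,A\Rightarrow\Delta,A\to B,B$ infer $\mathcal G\mid\Gamma\Rightarrow\Delta,A\to B$; $\preccurlyeq_L$: from $\mathcal G\mid\Gamma,A\preccurlyeq B\Rightarrow\Delta,[B,\Sigma\lhd C]$ and $\mathcal G\mid\Gamma,A\preccurlyeq B\Rightarrow\Delta,[\Sigma\lhd C],[\Sigma\lhd A]$ infer $\mathcal G\mid\Gamma,A\preccurlyeq B\Rightarrow\Delta,[\Sigma\lhd C]$; $\preccurlyeq_R$: from $\mathcal G\mid\Gamma\Rightarrow\Delta,A\preccurlyeq B,[A\lhd B]$ infer $\mathcal G\mid\Gamma\Rightarrow\Delta,A\preccurlyeq B$; jp: from $\mathcal G\mid\Gamma\Rightarrow\Delta,[\Sigma\lhd A]\mid A\Rightarrow\Sigma$ infer $\mathcal G\mid\Gamma\Rightarrow\Delta,[\Sigma\lhd A]$; N: from $\mathcal G\mid\Gamma\Rightarrow\Delta,[\bot\lhd\top]$ infer $\mathcal G\mid\Gamma\Rightarrow\Delta$; T: from $\mathcal G\mid\Gamma,A\preccurlyeq B\Rightarrow\Delta,B$ and $\mathcal G\mid\Gamma,A\preccurlyeq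 B\Rightarrow\Delta,[\bot\lhd A]$ infer $\mathcal G\mid\Gamma,A\preccurlyeq B\Rightarrow\Delta$; W: from $\mathcal G\mid\Gamma\Rightarrow\Delta,[\Sigma\lhd A],\Sigma$ infer $\mathcal G\mid\Gamma\Rightarrow\Delta,[\Sigma\lhd A]$; C: from $\mathcal G\mid\Gamma,A\preccurlyeq B\Rightarrow\Delta,B$ and $\mathcal G\mid\Gamma,A\preccurlyeq B,A\Rightarrow\Delta$ infer $\mathcal G\mid\Gamma,A\preccurlyeq B\Rightarrow\Delta$; $\mathrm A_L$: from $\mathcal G\mid\Gamma,A\preccurlyeq B\Rightarrow\Delta\mid\Omega,A\preccurlyeq B\Rightarrow\Theta$ infer $\mathcal G\mid\Gamma,A\preccurlyeq B\Rightarrow\Delta\mid\Omega\Rightarrow\Theta$; $\mathrm A_R$: from $\mathcal G\mid\Gamma\Rightarrow\Delta,A\preccurlyeq B\mid\Omega\Rightarrow\Theta,A\preccurlyeq B$ infer $\mathcal G\mid\Gamma\Rightarrow\Delta,A\preccurlyeq B\mid\Omega\Rightarrow\Theta$. $\mathsf{H.N}=\{\mathrm{init},\bot_L,\to_L,\to_R,\preccurlyeq_L,\preccurlyeq_R,\mathrm{jp}\}$; $\mathsf{H.NN}=\mathsf{H.N}+$N; $\mathsf{H.NT}=\mathsf{H.N}+$T; $\mathsf{H.NW}=\mathsf{H.N}+$T,W; $\mathsf{H.NC}=\mathsf{H.N}+$W,C; $\mathsf{H.NA}=\mathsf{H.N}+\mathrm A_L,\mathrm A_R$; $\mathsf{H.NNA}=\mathsf{H.NN}+\mathrm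 A_L,\mathrm A_R$. *)

(* Defs.v *)
From HB Require Import structures.
From mathcomp Require Import all_boot.
From mathcomp Require Import finmap multiset.

Set Implicit Arguments.
Unset Strict Implicit.
Unset Printing Implicit Defensive.

Local Open Scope mset_scope.
Local Open Scope nat_scope.

Inductive form : Type :=
| Atom of nat
| Bot
| Imp of form & form
| Cmp of form & form.

Declare Scope form_scope.
Delimit Scope form_scope with form.
Bind Scope form_scope with form.
Notation "A --> B" := (Imp A B)
  (at level 60, right associativity) : form_scope.
Notation "A ≼ B" := (Cmp A B)
  (at level 70, no associativity) : form_scope.
Local Open Scope form_scope.

Definition Top : form := Bot --> Bot.

(* A choiceType structure on formulas is needed to form multisets of them. *)
Fixpoint form_encode (A : form) : GenTree.tree nat :=
  match A with
  | Atom p => GenTree.Leaf p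
  | Bot => GenTree.Node 0 [::]
  | B --> C => GenTree.Node 1 [:: form_encode B; form_encode C]
  | B ≼ C => GenTree.Node 2 [:: form_encode B; form_encode C]
  end.

Fixpoint form_decode (t : GenTree.tree nat) : form :=
  match t with
  | GenTree.Leaf p => Atom p
  | GenTree.Node 1 [:: t1; t2] => form_decode t1 --> form_decode t2
  | GenTree.Node 2 [:: t1; t2] => form_decode t1 ≼ form_decode t2
  | GenTree.Node _ _ => Bot
  end.

Lemma form_encodeK : cancel form_encode form_decode.
Proof. by elim=> //= A -> B ->. Qed.

HB.instance Definition _ := Countable.copy form (can_type form_encodeK).

Definition is_cmp (A : form) : bool := if A is _ ≼ _ then true else false.

Definition cmps (G : {mset form}) : {mset form} :=
  seq_mset [seq A <- G | is_cmp A].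

(* Derivability from a set of rule instances, each given by its list of
   premises and its conclusion. *)
Inductive derivable (S : eqType) (rule : seq S -> S -> Prop) : S -> Prop :=
| Derive (ps : seq S) (c : S) :
    rule ps c -> (forall p, p \in ps -> derivable rule p) -> derivable rule c.

Inductive extension : Type := ExtE | ExtN | ExtT | ExtW | ExtC | ExtA | ExtNA.

Definition sequent : Type := ({mset form} * {mset form})%type.
HB.instance Definition _ := Choice.on sequent.

Definition mkSequent (G D : {mset form}) : sequent := (G, D).

Declare Scope sequent_scope.
Notation "G ⇒ D" := (mkSequent G%mset D%mset)
  (at level 70, no associativity) : sequent_scope.
Local Open Scope sequent_scope.

Inductive grule_name : Type :=
| G_init | G_botL | G_impL | G_impR
| G_CP of nat | G_N of nat | G_T of nat | G_W of nat | G_C0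
| G_A of nat | G_NA of nat.

(* The formulas C_1 ≼ D_1, ..., C_n ≼ D_n of an n-ary rule are indexed from 0:
   C_(k+1) and D_(k+1) are [C k] and [E k], where only the first n values of
   C, E : nat -> form matter.  [firsts E k] is the multiset D_1, ..., D_k, which
   occurs in the succedent of the premise for C_(k+1). *)
Definition firsts (E : nat -> form) (k : nat) : {mset form} :=
  seq_mset (mkseq E k).

Definition sigma (C E : nat -> form) (n : nat) : {mset form} :=
  seq_mset (mkseq (fun k => C k ≼ E k) n).

Implicit Types (A B : form) (G D S : {mset form}) (C E : nat -> form).

Inductive grule : grule_name -> seq sequent -> sequent -> Prop :=
| Grule_init G D p :
    grule G_init [::] (Atom p +` G ⇒ Atom p +` D)
| Grule_botL G D :
    grule G_botL [::] (Bot +` G ⇒ D)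
| Grule_impL G D A B :
    grule G_impL
      [:: G ⇒ A +` D;
          B +` G ⇒ D]
      ((A --> B) +` G ⇒ D)
| Grule_impR G D A B :
    grule G_impR
      [:: A +` G ⇒ B +` D]
      (G ⇒ (A --> B) +` D)
| Grule_CP n C E G D A B :
    grule (G_CP n)
      (rcons (mkseq (fun k => [mset C k] ⇒ A +` firsts E k) n)
             ([mset B] ⇒ A +` firsts E n))
      (G `+` sigma C E n ⇒ (A ≼ B) +` D)
| Grule_N n C E G D :
    grule (G_N n)
      (rcons (mkseq (fun k => [mset C k] ⇒ firsts E k) n)
             (mset0 ⇒ firsts E n))
      (G `+` sigma C E n ⇒ D)
| Grule_T n C E G D :
    grule (G_T n)
      (rcons (mkseq (fun k => [mset C k] ⇒ firsts E k) n)
             (G `+` sigma C E n ⇒ firsts E n `+` D))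
      (G `+` sigma C E n ⇒ D)
| Grule_W n C E G D A B :
    grule (G_W n)
      (rcons (mkseq (fun k => [mset C k] ⇒ A +` firsts E k) n)
             (G `+` sigma C E n ⇒ A +` ((A ≼ B) +` (firsts E n `+` D))))
      (G `+` sigma C E n ⇒ (A ≼ B) +` D)
| Grule_C0 G D A B :
    grule G_C0
      [:: A +` ((A ≼ B) +` G) ⇒ D;
          (A ≼ B) +` G ⇒ B +` D]
      ((A ≼ B) +` G ⇒ D)
| Grule_A n C E G D A B :
    grule (G_A n)
      (rcons
         (mkseq (fun k => C k +` (cmps G `+` sigma C E n) ⇒
                   (A ≼ B) +` (A +` (firsts E k `+` cmps D))) n)
         (B +` (cmps G `+` sigma C E n) ⇒
            (A ≼ B) +` (A +` (firsts E n `+` cmps D))))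
      (G `+` sigma C E n ⇒ (A ≼ B) +` D)
| Grule_NA n C E G D :
    grule (G_NA n)
      (rcons
         (mkseq (fun k => C k +` (cmps G `+` sigma C E n) ⇒
                   firsts E k `+` cmps D) n)
         (cmps G `+` sigma C E n ⇒ firsts E n `+` cmps D))
      (G `+` sigma C E n ⇒ D).

Definition gcalculus (X : extension) (r : grule_name) : bool :=
  match r with
  | G_init | G_botL | G_impL | G_impR => true
  | G_CP _ => match X with ExtA | ExtNA => false | _ => true end
  | G_N n => (0 < n) && (if X is ExtN then true else false)
  | G_T n => (0 < n) && (match X with ExtT | ExtW => true | _ => false end)
  | G_W n => match X with ExtW => true | ExtC => n == 0 | _ => false end
  | G_C0 => if X is ExtC then true else false
  | G_A _ => match X with ExtA | ExtNA => true | _ => false end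
  | G_NA n => (0 < n) && (if X is ExtNA then true else false)
  end.

Definition Gderivable (X : extension) : sequent -> Prop :=
  derivable (fun ps c => exists2 r, gcalculus X r & grule r ps c).

Definition block : Type := ({mset form} * form)%type.
HB.instance Definition _ := Choice.on block.

Definition mkBlock (S : {mset form}) (A : form) : block := (S, A).
Notation "S ◁ A" := (mkBlock S%mset A%form)
  (at level 70, no associativity) : sequent_scope.

(* The succedent, a finite multiset of formulas and blocks, is given as the pair
   of the multiset of its formulas and the multiset of its blocks. *)
Definition bsequent : Type :=
  ({mset form} * ({mset form} * {mset block}))%type.
HB.instance Definition _ := Choice.on bsequent.

Definition mkBSequent (G D : {mset form}) (K : {mset block}) : bsequent :=
  (G, (D, K)).
Notation "G ⇒ D ;; K" := (mkBSequent G%mset D%mset K%mset)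
  (at level 70, D at next level, K at next level, no associativity)
  : sequent_scope.

Definition hypersequent : Type := {mset bsequent}.
HB.instance Definition _ := Choice.on hypersequent.

Implicit Types (K : {mset block}) (H : hypersequent).

Inductive hrule_name : Type :=
| H_init | H_botL | H_impL | H_impR | H_cmpL | H_cmpR | H_jp
| H_N | H_T | H_W | H_C | H_AL | H_AR.

Inductive hrule : hrule_name -> seq hypersequent -> hypersequent -> Prop :=
| Hrule_init H G D K p :
    hrule H_init [::] ((Atom p +` G ⇒ Atom p +` D ;; K) +` H)
| Hrule_botL H G D K :
    hrule H_botL [::] ((Bot +` G ⇒ D ;; K) +` H)
| Hrule_impL H G D K A B :
    hrule H_impL
      [:: (B +` ((A --> B) +` G) ⇒ D ;; K) +` H;
          ((A --> B) +` G ⇒ A +` D ;; K) +` H]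
      (((A --> B) +` G ⇒ D ;; K) +` H)
| Hrule_impR H G D K A B :
    hrule H_impR
      [:: (A +` G ⇒ B +` ((A --> B) +` D) ;; K) +` H]
      ((G ⇒ (A --> B) +` D ;; K) +` H)
| Hrule_cmpL H G D K A B S (C : form) :
    hrule H_cmpL
      [:: ((A ≼ B) +` G ⇒ D ;; (B +` S ◁ C) +` K) +` H;
          ((A ≼ B) +` G ⇒ D ;; (S ◁ C) +` ((S ◁ A) +` K)) +` H]
      (((A ≼ B) +` G ⇒ D ;; (S ◁ C) +` K) +` H)
| Hrule_cmpR H G D K A B :
    hrule H_cmpR
      [:: (G ⇒ (A ≼ B) +` D ;; ([mset A] ◁ B) +` K) +` H]
      ((G ⇒ (A ≼ B) +` D ;; K) +` H)
| Hrule_jp H G D K S A :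
    hrule H_jp
      [:: (G ⇒ D ;; (S ◁ A) +` K) +` (([mset A] ⇒ S ;; mset0) +` H)]
      ((G ⇒ D ;; (S ◁ A) +` K) +` H)
| Hrule_N H G D K :
    hrule H_N
      [:: (G ⇒ D ;; ([mset Bot] ◁ Top) +` K) +` H]
      ((G ⇒ D ;; K) +` H)
| Hrule_T H G D K A B :
    hrule H_T
      [:: ((A ≼ B) +` G ⇒ B +` D ;; K) +` H;
          ((A ≼ B) +` G ⇒ D ;; ([mset Bot] ◁ A) +` K) +` H]
      (((A ≼ B) +` G ⇒ D ;; K) +` H)
| Hrule_W H G D K S A :
    hrule H_W
      [:: (G ⇒ S `+` D ;; (S ◁ A) +` K) +` H]
      ((G ⇒ D ;; (S ◁ A) +` K) +` H)
| Hrule_C H G D K A B :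
    hrule H_C
      [:: ((A ≼ B) +` G ⇒ B +` D ;; K) +` H;
          (A +` ((A ≼ B) +` G) ⇒ D ;; K) +` H]
      (((A ≼ B) +` G ⇒ D ;; K) +` H)
| Hrule_AL H G D K G' D' K' A B :
    hrule H_AL
      [:: ((A ≼ B) +` G ⇒ D ;; K) +` (((A ≼ B) +` G' ⇒ D' ;; K') +` H)]
      (((A ≼ B) +` G ⇒ D ;; K) +` ((G' ⇒ D' ;; K') +` H))
| Hrule_AR H G D K G' D' K' A B :
    hrule H_AR
      [:: (G ⇒ (A ≼ B) +` D ;; K) +` ((G' ⇒ (A ≼ B) +` D' ;; K') +` H)]
      ((G ⇒ (A ≼ B) +` D ;; K) +` ((G' ⇒ D' ;; K') +` H)).

Definition hcalculus (X : extension) (r : hrule_name) : bool :=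
  match r with
  | H_init | H_botL | H_impL | H_impR | H_cmpL | H_cmpR | H_jp => true
  | H_N => match X with ExtN | ExtNA => true | _ => false end
  | H_T => match X with ExtT | ExtW => true | _ => false end
  | H_W => match X with ExtW | ExtC => true | _ => false end
  | H_C => if X is ExtC then true else false
  | H_AL | H_AR => match X with ExtA | ExtNA => true | _ => false end
  end.

Definition Hderivable (X : extension) : hypersequent -> Prop :=
  derivable (fun ps c => exists2 r, hcalculus X r & hrule r ps c).

(* Main.v *)
Require Import Defs.
From mathcomp Require Import all_boot.
From mathcomp Require Import finmap multiset.

Set Implicit Arguments.
Unset Strict Implicit.
Unset Printing Implicit Defensive.

Local Open Scope mset_scope.
Local Open Scope sequent_scope.

(** Apart from [H_cmpL], which enlarges a block, the hypersequent rules keep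
    their principal formulas and blocks.  So derivability of a sequent with
    blocks can be strengthened ([Hstable] below) to derivability of every
    hypersequent with a component whose formulas include those of the sequent
    on each side, as sets; this absorbs weakening and contraction, and all
    sequent rules preserve the strengthened notion.  For the n-ary rules, a
    block [S ◁ B] is enlarged by [H_cmpL] with C_1 ≼ D_1, ..., C_n ≼ D_n in this
    order, from the root upwards: the side branches carry the blocks
    [S, D_1, ..., D_(k-1) ◁ C_k] and the main branch ends with
    [S, D_1, ..., D_n ◁ B].  Jumping from these blocks yields the premises of
    the sequent rule. *)

Lemma in_rcons_mkseq (T : eqType) (P : T -> Prop) (f : nat -> T) n x :
  {in rcons (mkseq f n) x, forall y, P y} ->
  (forall k, k < n -> P (f k)) /\ P x.
Proof.
move=> Pf; split=> [k lt_kn|]; apply: Pf; rewrite mem_rcons inE ?eqxx //.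
by rewrite map_f ?orbT // mem_iota.
Qed.

Section MultisetsAsSets.

Variable T : choiceType.
Implicit Types (a : T) (U V W : {mset T}).

Lemma sub_msetDr U V : {subset V <= U `+` V}.
Proof. by move=> x xV; rewrite in_msetD xV orbT. Qed.

Lemma sub_msetDS W U V : {subset U <= V} -> {subset W `+` U <= W `+` V}.
Proof.
by move=> sUV x; rewrite !in_msetD => /orP[->|/sUV->]; rewrite ?orbT.
Qed.

Lemma sub_mset1D a U V :
  {subset a +` U <= V} -> a \in V /\ {subset U <= V}.
Proof.
by move=> sUV; split=> [|x xU]; apply: sUV; [apply: mset1D1 | apply: mset1Dr].
Qed.

Lemma seq_mset_nil : seq_mset [::] = mset0 :> {mset T}.
Proof. by apply/msetP=> x; rewrite mset_seqE mset0E. Qed.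

Lemma mset_absorb (P : {mset T} -> Prop) U V :
  (forall a W, a \in U -> P (a +` W) -> P W) -> P (U `+` V) -> P V.
Proof.
move=> Pabs; rewrite -[U in U `+` V]seq_mset_id.
have: {subset enum_mset U <= U} by [].
elim: (enum_mset U) => [|a s IHs] sU; first by rewrite seq_mset_nil mset0D.
rewrite mset_cons -msetDA => /(Pabs a _ (sU a (mem_head _ _))).
by apply: IHs => x xs; apply: sU; rewrite inE xs orbT.
Qed.

End MultisetsAsSets.

Implicit Types (A B F : form) (G D S : {mset form}) (C E : nat -> form).
Implicit Types (K : {mset block}) (H : hypersequent).

Lemma firsts0 E : firsts E 0 = mset0.
Proof. exact: seq_mset_nil. Qed.

Lemma firstsS E n : firsts E n.+1 = E n +` firsts E n.
Proof.
by rewrite -mset_cons; apply/eq_seq_msetP; rewrite mkseqS perm_rcons.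
Qed.

Lemma sigmaS C E n : sigma C E n.+1 = (C n ≼ E n)%form +` sigma C E n.
Proof. exact: (firstsS (fun k => C k ≼ E k)%form). Qed.

Lemma cmpsE G A : cmps G A = if is_cmp A then G A else 0.
Proof.
rewrite mset_seqE count_filter; case: ifPn => [Acmp | /negbTE Ncmp].
  rewrite -count_mem_mset; apply: eq_count => F /=.
  by case: eqP => // ->; rewrite Acmp.
by rewrite (@eq_count _ _ pred0) ?count_pred0 // => F /=; case: eqP => // ->.
Qed.

Lemma mem_cmps G A : (A \in cmps G) = is_cmp A && (A \in G).
Proof. by rewrite !in_mset cmpsE; case: is_cmp. Qed.

Lemma sub_cmps G G' : {subset G <= G'} -> {subset cmps G <= cmps G'}.
Proof. by move=> sG A; rewrite !mem_cmps => /andP[-> /sG]. Qed.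

Lemma cmpsD G D : cmps (G `+` D) = cmps G `+` cmps D.
Proof. by apply/msetP=> A; rewrite msetE2 !cmpsE msetE2; case: is_cmp. Qed.

Lemma cmps_id G : {in G, forall A, is_cmp A} -> cmps G = G.
Proof.
move=> Gcmp; apply/msetP=> A; rewrite cmpsE.
by case: ifPn => // /(contra (@Gcmp A)) /mset_eq0P.
Qed.

Lemma cmps_cmpD A B G : cmps ((A ≼ B)%form +` G) = (A ≼ B)%form +` cmps G.
Proof. by rewrite cmpsD cmps_id // => F /mset1P->. Qed.

Lemma cmps_sigma C E n : cmps (sigma C E n) = sigma C E n.
Proof.
apply: cmps_id => A; rewrite (perm_mem (perm_eq_seq_mset _)).
by move=> /mapP[k _ ->].
Qed.

Section StableDerivability.

Variable X : extension.

Lemma Hderivable_rule r ps c :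
  hcalculus X r -> hrule r ps c -> {in ps, forall p, Hderivable X p} ->
  Hderivable X c.
Proof. by move=> Xr rc ?; apply: (@Derive _ _ ps) => //; exists r. Qed.

Lemma Hderivable_AL G D K G' D' K' H :
  hcalculus X H_AL ->
  Hderivable X ((G ⇒ D ;; K) +` ((cmps G `+` G' ⇒ D' ;; K') +` H)) ->
  Hderivable X ((G ⇒ D ;; K) +` ((G' ⇒ D' ;; K') +` H)).
Proof.
move=> XA.
apply: (mset_absorb (P := fun G' =>
  Hderivable X ((G ⇒ D ;; K) +` ((G' ⇒ D' ;; K') +` H)))) => {G'}.
case=> [p||A B|A B] G'; rewrite mem_cmps //= => /msetB1K<- d.
apply: Hderivable_rule XA (Hrule_AL _ _ _ _ _ _ _ _ _) _ => p.
by rewrite !inE => /eqP->.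
Qed.

Lemma Hderivable_AR G D K G' D' K' H :
  hcalculus X H_AR ->
  Hderivable X ((G ⇒ D ;; K) +` ((G' ⇒ cmps D `+` D' ;; K') +` H)) ->
  Hderivable X ((G ⇒ D ;; K) +` ((G' ⇒ D' ;; K') +` H)).
Proof.
move=> XA.
apply: (mset_absorb (P := fun D' =>
  Hderivable X ((G ⇒ D ;; K) +` ((G' ⇒ D' ;; K') +` H)))) => {D'}.
case=> [p||A B|A B] D'; rewrite mem_cmps //= => /msetB1K<- d.
apply: Hderivable_rule XA (Hrule_AR _ _ _ _ _ _ _ _ _) _ => p.
by rewrite !inE => /eqP->.
Qed.

(* Blocks keep their multiplicity, since [H_cmpL] replaces one occurrence of a
   block instead of adding to it. *)
Definition Hstable (s : bsequent) : Prop :=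
  forall G D K H, {subset s.1 <= G} -> {subset s.2.1 <= D} ->
    Hderivable X ((G ⇒ D ;; s.2.2 `+` K) +` H).

Lemma Hstable_sub G D K G' D' :
  {subset G <= G'} -> {subset D <= D'} ->
  Hstable (G ⇒ D ;; K) -> Hstable (G' ⇒ D' ;; K).
Proof.
move=> sG sD st G1 D1 K1 H sG1 sD1.
by apply: st => /= A => [/sG/sG1|/sD/sD1].
Qed.

Lemma Hstable_add_blocks G D K K' :
  Hstable (G ⇒ D ;; K) -> Hstable (G ⇒ D ;; K' `+` K).
Proof.
by move=> st G1 D1 K1 H sG1 sD1; rewrite -msetDA msetDCA; apply: st.
Qed.

Lemma Hstable_H_init G D K p :
  Atom p \in G -> Atom p \in D -> Hstable (G ⇒ D ;; K).
Proof.
move=> Gp Dp G' D' K' H /= /(_ _ Gp)/msetB1K<- /(_ _ Dp)/msetB1K<-.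
by apply: Hderivable_rule (Hrule_init _ _ _ _ _) _.
Qed.

Lemma Hstable_H_botL G D K : Bot \in G -> Hstable (G ⇒ D ;; K).
Proof.
move=> GBot G' D' K' H /= /(_ _ GBot)/msetB1K<- _.
by apply: Hderivable_rule (Hrule_botL _ _ _ _) _.
Qed.

Lemma Hstable_H_impL G D K A B :
  (A --> B)%form \in G -> Hstable (B +` G ⇒ D ;; K) ->
  Hstable (G ⇒ A +` D ;; K) -> Hstable (G ⇒ D ;; K).
Proof.
move=> GAB stB stA G' D' K' H sG sD.
have /msetB1K eqG' := sG _ GAB; rewrite -eqG'.
apply: Hderivable_rule (Hrule_impL _ _ _ _ _ _) _ => // p.
rewrite !inE eqG' => /orP[]/eqP->; [apply: stB | apply: stA] => //;
  exact: sub_msetDS.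
Qed.

Lemma Hstable_H_impR G D K A B :
  (A --> B)%form \in D -> Hstable (A +` G ⇒ B +` D ;; K) ->
  Hstable (G ⇒ D ;; K).
Proof.
move=> DAB st G' D' K' H sG sD.
have /msetB1K eqD' := sD _ DAB; rewrite -eqD'.
apply: Hderivable_rule (Hrule_impR _ _ _ _ _ _) _ => // p.
by rewrite !inE eqD' => /eqP->; apply: st => //; apply: sub_msetDS.
Qed.

Lemma Hstable_H_cmpL G D K A B S F :
  (A ≼ B)%form \in G -> Hstable (G ⇒ D ;; (B +` S ◁ F) +` K) ->
  Hstable (G ⇒ D ;; (S ◁ A) +` K) -> Hstable (G ⇒ D ;; (S ◁ F) +` K).
Proof.
move=> GAB stB stA G' D' K' H sG sD.
have /msetB1K eqG' := sG _ GAB; rewrite -eqG' -msetDA.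
apply: Hderivable_rule (Hrule_cmpL _ _ _ _ _ _ _ _) _ => // p.
rewrite !inE eqG' => /orP[]/eqP->; first by rewrite msetDA; apply: stB.
by rewrite msetDCA [[mset _] `+` (K `+` _)]msetDCA msetDA; apply: stA.
Qed.

Lemma Hstable_H_cmpR G D K A B :
  (A ≼ B)%form \in D -> Hstable (G ⇒ D ;; ([mset A] ◁ B) +` K) ->
  Hstable (G ⇒ D ;; K).
Proof.
move=> DAB st G' D' K' H sG sD.
have /msetB1K eqD' := sD _ DAB; rewrite -eqD'.
apply: Hderivable_rule (Hrule_cmpR _ _ _ _ _ _) _ => // p.
by rewrite !inE eqD' => /eqP->; rewrite msetDA; apply: st.
Qed.

Lemma Hstable_H_jp G D K S A :
  Hstable ([mset A] ⇒ S ;; mset0) -> Hstable (G ⇒ D ;; (S ◁ A) +` K).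
Proof.
move=> st G' D' K' H sG sD; rewrite -msetDA.
apply: Hderivable_rule (Hrule_jp _ _ _ _ _ _) _ => // p.
by rewrite !inE => /eqP->; rewrite msetDCA -[mset0]mset0D; apply: st.
Qed.

Lemma Hstable_H_N G D K :
  hcalculus X H_N -> Hstable (G ⇒ D ;; ([mset Bot] ◁ Top) +` K) ->
  Hstable (G ⇒ D ;; K).
Proof.
move=> XN st G' D' K' H sG sD.
apply: Hderivable_rule XN (Hrule_N _ _ _ _) _ => p.
by rewrite !inE => /eqP->; rewrite msetDA; apply: st.
Qed.

Lemma Hstable_H_T G D K A B :
  hcalculus X H_T -> (A ≼ B)%form \in G ->
  Hstable (G ⇒ B +` D ;; K) -> Hstable (G ⇒ D ;; ([mset Bot] ◁ A) +` K) ->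
  Hstable (G ⇒ D ;; K).
Proof.
move=> XT GAB stB stA G' D' K' H sG sD.
have /msetB1K eqG' := sG _ GAB; rewrite -eqG'.
apply: Hderivable_rule XT (Hrule_T _ _ _ _ _ _) _ => p.
rewrite !inE eqG' => /orP[]/eqP->; last by rewrite msetDA; apply: stA.
by apply: stB => //; apply: sub_msetDS.
Qed.

Lemma Hstable_H_W G D K S A :
  hcalculus X H_W -> Hstable (G ⇒ S `+` D ;; (S ◁ A) +` K) ->
  Hstable (G ⇒ D ;; (S ◁ A) +` K).
Proof.
move=> XW st G' D' K' H sG sD; rewrite -msetDA.
apply: Hderivable_rule XW (Hrule_W _ _ _ _ _ _) _ => p.
by rewrite !inE => /eqP->; rewrite msetDA; apply: st => //; apply: sub_msetDS.
Qed.

Lemma Hstable_H_C G D K A B :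
  hcalculus X H_C -> (A ≼ B)%form \in G ->
  Hstable (G ⇒ B +` D ;; K) -> Hstable (A +` G ⇒ D ;; K) ->
  Hstable (G ⇒ D ;; K).
Proof.
move=> XC GAB stB stA G' D' K' H sG sD.
have /msetB1K eqG' := sG _ GAB; rewrite -eqG'.
apply: Hderivable_rule XC (Hrule_C _ _ _ _ _ _) _ => p.
rewrite !inE eqG' => /orP[]/eqP->; [apply: stB | apply: stA] => //;
  exact: sub_msetDS.
Qed.

Lemma Hstable_H_jp_AL_AR G D K S A :
  hcalculus X H_AL -> hcalculus X H_AR ->
  Hstable (A +` cmps G ⇒ S `+` cmps D ;; mset0) ->
  Hstable (G ⇒ D ;; (S ◁ A) +` K).
Proof.
move=> XAL XAR st G' D' K' H sG sD; rewrite -msetDA.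
apply: Hderivable_rule (Hrule_jp _ _ _ _ _ _) _ => // p.
rewrite !inE => /eqP->; apply: Hderivable_AL XAL _; apply: Hderivable_AR XAR _.
rewrite msetDCA -[mset0]mset0D (msetDC (cmps G')) (msetDC (cmps D')).
by apply: st; apply/sub_msetDS/sub_cmps.
Qed.

Lemma Hstable_cmpL_sigma G D K C E n S B :
  {subset sigma C E n <= G} ->
  (forall k, k < n -> Hstable (G ⇒ D ;; (S `+` firsts E k ◁ C k) +` K)) ->
  Hstable (G ⇒ D ;; (S `+` firsts E n ◁ B) +` K) ->
  Hstable (G ⇒ D ;; (S ◁ B) +` K).
Proof.
elim: n => [|n IHn]; first by rewrite firsts0 msetD0.
rewrite sigmaS firstsS => /sub_mset1D[GCE sGCE] side main.
apply: (IHn sGCE) => [k /ltnW|]; first exact: side.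
apply: Hstable_H_cmpL GCE _ _; first by rewrite msetDCA.
exact: side.
Qed.

Lemma Hstable_G_impL G D K A B :
  Hstable (G ⇒ A +` D ;; K) -> Hstable (B +` G ⇒ D ;; K) ->
  Hstable ((A --> B)%form +` G ⇒ D ;; K).
Proof.
move=> stA stB; apply: Hstable_H_impL (mset1D1 _ _) _ _.
  by apply: Hstable_sub stB => //; apply/sub_msetDS/sub_msetDr.
by apply: Hstable_sub stA => //; apply: sub_msetDr.
Qed.

Lemma Hstable_G_impR G D K A B :
  Hstable (A +` G ⇒ B +` D ;; K) -> Hstable (G ⇒ (A --> B)%form +` D ;; K).
Proof.
move=> st; apply: Hstable_H_impR (mset1D1 _ _) _.
by apply: Hstable_sub st => //; apply/sub_msetDS/sub_msetDr.
Qed.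

Lemma Hstable_G_CP n C E G D K A B :
  (forall k, k < n -> Hstable ([mset C k] ⇒ A +` firsts E k ;; mset0)) ->
  Hstable ([mset B] ⇒ A +` firsts E n ;; mset0) ->
  Hstable (G `+` sigma C E n ⇒ (A ≼ B)%form +` D ;; K).
Proof.
move=> stC stB; apply: Hstable_H_cmpR (mset1D1 _ _) _.
apply: Hstable_cmpL_sigma (@sub_msetDr _ _ _) _ _ => [k /stC|].
  exact: Hstable_H_jp.
exact: Hstable_H_jp.
Qed.

Lemma Hstable_G_N n C E G D K :
  hcalculus X H_N ->
  (forall k, k < n -> Hstable ([mset C k] ⇒ firsts E k ;; mset0)) ->
  Hstable (mset0 ⇒ firsts E n ;; mset0) ->
  Hstable (G `+` sigma C E n ⇒ D ;; K).
Proof.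
move=> XN stC st; apply: (Hstable_H_N XN).
apply: Hstable_cmpL_sigma (@sub_msetDr _ _ _) _ _ => [k /stC {}st|];
  apply: Hstable_H_jp; apply: Hstable_sub st => //; first exact: sub_msetDr.
- by move=> x; rewrite in_mset0.
- exact: sub_msetDr.
Qed.

Lemma Hstable_G_T n C E G D K :
  hcalculus X H_T -> {subset sigma C E n <= G} ->
  (forall k, k < n -> Hstable ([mset C k] ⇒ firsts E k ;; mset0)) ->
  Hstable (G ⇒ firsts E n `+` D ;; K) -> Hstable (G ⇒ D ;; K).
Proof.
move=> XT; elim: n => [|n IHn]; first by rewrite firsts0 mset0D.
rewrite sigmaS firstsS -msetDA => /sub_mset1D[GCE sGCE] stC main.
have jump D' k F : Hstable ([mset F] ⇒ firsts E k ;; mset0) ->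
    Hstable (G ⇒ D' ;; ([mset Bot] `+` firsts E k ◁ F) +` K).
  move=> st; apply: Hstable_H_jp.
  by apply: Hstable_sub st => //; apply: sub_msetDr.
apply: (IHn sGCE) => [k /ltnW|]; first exact: stC.
apply: (Hstable_H_T XT GCE); first exact: main.
apply: Hstable_cmpL_sigma sGCE _ _ => [k /ltnW/stC|]; first exact: jump.
exact/jump/stC.
Qed.

Lemma Hstable_G_W n C E G D K A B :
  hcalculus X H_W ->
  (forall k, k < n -> Hstable ([mset C k] ⇒ A +` firsts E k ;; mset0)) ->
  Hstable (G `+` sigma C E n ⇒
             A +` ((A ≼ B)%form +` (firsts E n `+` D)) ;; K) ->
  Hstable (G `+` sigma C E n ⇒ (A ≼ B)%form +` D ;; K).
Proof.
move=> XW stC st; apply: Hstable_H_cmpR (mset1D1 _ _) _.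
apply: Hstable_cmpL_sigma (@sub_msetDr _ _ _) _ _ => [k /stC|].
  exact: Hstable_H_jp.
apply: (Hstable_H_W XW); rewrite -msetDA [firsts E n `+` _]msetDCA.
exact: Hstable_add_blocks.
Qed.

Lemma Hstable_G_A n C E G D K A B :
  hcalculus X H_AL -> hcalculus X H_AR ->
  (forall k, k < n ->
     Hstable (C k +` (cmps G `+` sigma C E n) ⇒
                (A ≼ B)%form +` (A +` (firsts E k `+` cmps D)) ;; mset0)) ->
  Hstable (B +` (cmps G `+` sigma C E n) ⇒
             (A ≼ B)%form +` (A +` (firsts E n `+` cmps D)) ;; mset0) ->
  Hstable (G `+` sigma C E n ⇒ (A ≼ B)%form +` D ;; K).
Proof.
move=> XAL XAR stC stB.
have jump k F :
    Hstable (F +` (cmps G `+` sigma C E n) ⇒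
               (A ≼ B)%form +` (A +` (firsts E k `+` cmps D)) ;; mset0) ->
    Hstable (G `+` sigma C E n ⇒ (A ≼ B)%form +` D ;;
               (A +` firsts E k ◁ F) +` K).
  move=> st; apply: Hstable_H_jp_AL_AR => //.
  rewrite cmpsD cmps_sigma cmps_cmpD.
  by rewrite [_ `+` ((A ≼ B)%form +` _)]msetDCA -msetDA.
apply: Hstable_H_cmpR (mset1D1 _ _) _.
apply: Hstable_cmpL_sigma (@sub_msetDr _ _ _) _ _ => [k /stC|]; exact: jump.
Qed.

Lemma Hstable_G_NA n C E G D K :
  hcalculus X H_N -> hcalculus X H_AL -> hcalculus X H_AR ->
  (forall k, k < n ->
     Hstable (C k +` (cmps G `+` sigma C E n) ⇒ firsts E k `+` cmps D ;;
                mset0)) ->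
  Hstable (cmps G `+` sigma C E n ⇒ firsts E n `+` cmps D ;; mset0) ->
  Hstable (G `+` sigma C E n ⇒ D ;; K).
Proof.
move=> XN XAL XAR stC st; apply: (Hstable_H_N XN).
apply: Hstable_cmpL_sigma (@sub_msetDr _ _ _) _ _ => [k /stC {}st|];
  apply: Hstable_H_jp_AL_AR => //; rewrite cmpsD cmps_sigma -msetDA;
  by apply: Hstable_sub st => //; apply: sub_msetDr.
Qed.

Lemma Gderivable_Hstable (s : sequent) :
  Gderivable X s -> Hstable (s.1 ⇒ s.2 ;; mset0).
Proof.
elim=> {s} ps c [r Xr rc] _ IH; case: r ps c / rc Xr IH => /=.
- by move=> G D p _ _; apply: Hstable_H_init; apply: mset1D1.
- by move=> G D _ _; apply/Hstable_H_botL/mset1D1.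
- move=> G D A B _ IH.
  apply: Hstable_G_impL (IH (_ ⇒ _) _) (IH (_ ⇒ _) _);
    by rewrite !inE eqxx ?orbT.
- by move=> G D A B _ IH; apply: Hstable_G_impR (IH (_ ⇒ _) _); rewrite inE.
- by move=> n C E G D A B _ /in_rcons_mkseq[]; apply: Hstable_G_CP.
- move=> n C E G D Xr /in_rcons_mkseq[]; apply: Hstable_G_N.
  by case: X Xr => //; rewrite andbF.
- move=> n C E G D Xr /in_rcons_mkseq[]; apply: Hstable_G_T (@sub_msetDr _ _ _).
  by case: X Xr => //; rewrite andbF.
- move=> n C E G D A B Xr /in_rcons_mkseq[/= stC stB].
  by apply: Hstable_G_W stC stB; case: X Xr.
- move=> G D A B Xr IH.
  apply: Hstable_H_C (mset1D1 _ _) (IH (_ ⇒ _) _) (IH (_ ⇒ _) _);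
    by rewrite ?inE ?eqxx ?orbT //; case: X Xr.
- move=> n C E G D A B Xr /in_rcons_mkseq[].
  by apply: Hstable_G_A; case: X Xr.
- move=> n C E G D /andP[_ Xr] /in_rcons_mkseq[].
  by apply: Hstable_G_NA; case: X Xr.
Qed.

End StableDerivability.

Theorem theorem5p4 (X : extension) (A : form) :
  Gderivable X (mset0 ⇒ [mset A]) ->
  Hderivable X [mset (mset0 ⇒ [mset A] ;; mset0)].
Proof.
move/Gderivable_Hstable => /(_ mset0 [mset A] mset0 mset0).
by rewrite /= !msetD0; apply.
Qed.
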